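(* Let $q:\mathsf D\to\mathbb R$ have sensitivity $\Delta q\in(0,\infty)$, and let $0\le a<b$. If $\Lambda\sim U(a,b)$ (uniform on $[a,b]$), then the Randomized DP Laplace mechanism with reciprocal scale $\Lambda$ is $$\ln\left[\frac{\alpha^2-\beta^2}{2\big((1+\beta)e^{-\beta}-(1+\alpha)e^{-\alpha}\big)}\right]\text{-differentially private},$$ where $\alpha=a\,\Delta q$ and $\beta=b\,\Delta q$.
   Context: Databases form a set $\mathsf D$ with a symmetric adjacency relation; the sensitivity of $q$ is $\Delta q=\sup\{|q(d)-q(d')|:d,d'\text{ adjacent}\}$. A mechanism $M$ is $\epsilon$-DP if $\mathbb P(M(d)\in S)\le e^\epsilon\mathbb P(M(d')\in S)$ for all adjacent $d,d'$ and Borel $S$. The Randomized DP Laplace mechanism with reciprocal-scale distribution $\Lambda$ (a random variable with values in $[0,\infty)$, positive a.s., playing the role of $1/b$ for the Laplace scale) is defined by $\mathcal M_q(d)=q(d)+W$, where conditionally on $\Lambda=\lambda$ the noise $W$ is Laplace with mean $0$ and scale $1/\lambda$, i.e. has density $\frac{\lambda}{2}e^{-\lambda|w|}$; the pair $(\Lambda,W)$ is drawn independently of $d$. *)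

(* Defs.v *)
From HB Require Import structures.
From mathcomp Require Import all_boot all_order all_algebra.
From mathcomp Require Import all_classical all_reals all_analysis.
From mathcomp Require Import uniform_distribution.
Set Implicit Arguments. Unset Strict Implicit. Unset Printing Implicit Defensive.
Import Order.TTheory GRing.Theory Num.Theory.
Local Open Scope classical_set_scope.
Local Open Scope ring_scope.

Definition sensitivity (R : realType) (D : Type) (adj : D -> D -> Prop)
  (q : D -> R) : \bar R :=
  ereal_sup [set x : \bar R | exists d d', adj d d' /\ x = (`|q d - q d'|)%:E].

Definition laplace_pdf (R : realType) (lam w : R) : R :=
  lam / 2 * expR (- (lam * `|w|)).

(* Law of the Randomized DP Laplace mechanism output M_q(d) = q(d) + W,
   where Lam : T -> R is a random variable on the probability space (T, P)
   (reciprocal-scale distribution) and, conditionally on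
   Lam = lam, W has density laplace_pdf lam; (Lam, W) independent of d:
   P(M_q(d) \in S) = E_Lam [ \int_S laplace_pdf Lam (x - q d) dx ]. *)
Definition rdp_laplace (dT : measure_display) (T : measurableType dT)
  (R : realType) (P : probability T R) (Lam : T -> R)
  (qd : R) (S : set R) : \bar R :=
  (\int[P]_w \int[lebesgue_measure]_(x in S)
      (laplace_pdf (Lam w) (x - qd))%:E)%E.

Definition differentially_private (R : realType) (D : Type)
  (adj : D -> D -> Prop) (M : D -> set R -> \bar R) (eps : R) : Prop :=
  forall d d', adj d d' -> forall S : set R, measurable S ->
    (M d S <= (expR eps)%:E * M d' S)%E.

(* Main.v *)
Require Import Defs.
From HB Require Import structures.
From mathcomp Require Import all_boot all_order all_algebra.
From mathcomp Require Import all_classical all_reals all_analysis.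
From mathcomp Require Import measurable_realfun uniform_distribution.
From mathcomp Require Import ring lra.
Import Order.TTheory GRing.Theory Num.Theory.
Import numFieldNormedType.Exports.
Local Open Scope classical_set_scope.
Local Open Scope ring_scope.

(** Let L(s) = E[Lambda/2 exp(-Lambda s)]; by Tonelli the output of the mechanism
has density x |-> L(|x - q(d)|), and L is nonincreasing, so it suffices that
L(t) <= e^eps L(t + Dq) for t >= 0.  The theorem's e^eps is L(0)/L(Dq).  With
y = eps / Dq, so that exp(-y Dq) = L(Dq)/L(0), Chebyshev's inequality
(exp(-Lambda Dq) - exp(-y Dq)) (exp(-Lambda t) - exp(-y t)) >= 0 integrated
against the weight Lambda/2 gives the claim, because the terms in exp(-y t)
cancel by the choice of y. *)

(** * Chebyshev's inequality for exponentials and Laplace transforms *)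

Lemma expR_chebyshev (R : realType) (x y D t : R) : 0 <= D -> 0 <= t ->
  0 <= (expR (- (x * D)) - expR (- (y * D))) *
       (expR (- (x * t)) - expR (- (y * t))).
Proof.
(* Both factors are nonincreasing in [x] and vanish at [x = y], so they have the same sign. *)
move=> D0 t0; have [xy|/ltW yx] := leP x y.
  by apply: mulr_ge0; rewrite subr_ge0 ler_expR lerN2 ler_wpM2r.
by apply: mulr_le0; rewrite subr_le0 ler_expR lerN2 ler_wpM2r.
Qed.

Lemma laplace_transform_shift d (T : measurableType d) (R : realType)
    (P : {measure set T -> \bar R}) (w X : T -> R) (D eps t : R) :
  measurable_fun setT w -> measurable_fun setT X ->
  (forall x, 0 <= w x) -> 0 < D -> 0 <= t ->
  let L (s : R) : \bar R := (\int[P]_x (w x * expR (- (X x * s)))%:E)%E in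
  (L 0%R < +oo)%E -> L D = ((expR (- eps))%:E * L 0%R)%E ->
  (L t <= (expR eps)%:E * L (t + D)%R)%E.
Proof.
move=> mw mX w0 D0 t0 L L0oo LD.
pose y := eps / D.
have yD : y * D = eps by rewrite /y divfK// gt_eqF.
pose c := expR (- eps); pose e := expR (- (y * t)).
have m s : measurable_fun setT (fun x => (w x * expR (- (X x * s)))%:E : \bar R).
  apply/measurable_EFinP; apply: measurable_funM => //.
  apply: measurableT_comp => //; apply: measurableT_comp => //.
  exact: measurable_funM.
have ge0 s x : (0 <= (w x * expR (- (X x * s)))%:E)%E.
  by rewrite lee_fin mulr_ge0// expR_ge0.
have Z k s : 0 <= k -> (k%:E * L s = \int[P]_x (k * (w x * expR (- (X x * s))))%:E)%E.
  by move=> k0; rewrite /L -ge0_integralZl.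
have mZ k s : measurable_fun setT (fun x => (k * (w x * expR (- (X x * s))))%:E : \bar R).
  by apply/measurable_EFinP/measurable_funM => //; exact/measurable_EFinP/m.
have ge0Z k s x : 0 <= k -> (0 <= (k * (w x * expR (- (X x * s))))%:E)%E.
  by move=> k0; rewrite lee_fin mulr_ge0// mulr_ge0// expR_ge0.
have c0 : 0 <= c by exact: expR_ge0.
have e0 : 0 <= e by exact: expR_ge0.
(* The expanded product with its negative terms moved across: every integrand is then nonnegative,
   and additivity needs no integrability. *)
have main : (c%:E * L t + e%:E * L D <= 1%:E * L (t + D)%R + (e * c)%:E * L 0%R)%E.
  rewrite !Z ?mulr_ge0// -!ge0_integralD//=; last 4 first.
  - by move=> x _; exact: ge0Z.
  - by move=> x _; apply: ge0Z; exact: mulr_ge0.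
  - by move=> x _; exact: ge0Z.
  - by move=> x _; exact: ge0Z.
  apply: ge0_le_integral => //=.
  - by move=> x _; rewrite adde_ge0// ge0Z.
  - exact: emeasurable_funD.
  - exact: emeasurable_funD.
  move=> x _; rewrite -!EFinD lee_fin -subr_ge0.
  have := mulr_ge0 (w0 x) (@expR_chebyshev R (X x) y D t (ltW D0) t0).
  rewrite yD -/c -/e mulr0 oppr0 expR0.
  have -> : expR (- (X x * (t + D))) = expR (- (X x * t)) * expR (- (X x * D)).
    by rewrite -expRD -opprD -mulrDr.
  by congr (_ <= _); ring.
(* Since [c * L 0 = L D], both sides of [main] contain [e * L D]; cancelling it in the extended
   reals requires finiteness, which comes from [L 0 < +oo]. *)
have LDfin : (e%:E * L D)%E \is a fin_num.
  rewrite LD -/c muleA -EFinM ge0_fin_numE ?mule_ge0//.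
  - by rewrite lte_mul_pinfty// lee_fin mulr_ge0.
  - by rewrite lee_fin mulr_ge0.
  - exact: integral_ge0.
rewrite mul1e EFinM -muleA -LD leeD2rE// in main.
have -> : L t = ((expR eps)%:E * (c%:E * L t))%E.
  by rewrite muleA -EFinM /c -expRD addrN expR0 mul1e.
by rewrite lee_pmul2l// lte_fin expR_gt0.
Qed.

(** * Closed forms of the integrals over [[a, b]] *)

Lemma integral_itv_id_expR (R : realType) (a b D : R) : a < b -> D != 0 ->
  (\int[lebesgue_measure]_(x in `[a, b]) (x * expR (- (x * D)))%:E =
   (((1 + a * D) * expR (- (a * D)) - (1 + b * D) * expR (- (b * D)))
     / D ^+ 2)%:E)%E.
Proof.
move=> ab D0.
(* Antiderivative obtained by integration by parts. *)
pose F x : R := - ((1 + x * D) * expR (- (x * D))) / D ^+ 2.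
have dF (x : R) : is_derive x 1 F (x * expR (- (x * D))).
  by apply: is_derive_eq; rewrite /GRing.scale/=; field.
have cF (x : R) : {for x, continuous F}.
  by apply: differentiable_continuous; apply/derivable1_diffP; exact: ex_derive.
rewrite (@continuous_FTC2 _ _ F)//.
- by rewrite -EFinB /F; congr EFin; field.
- apply: continuous_subspaceT => x.
  apply: differentiable_continuous; apply/derivable1_diffP; exact: ex_derive.
- split => //.
  + by apply: cvg_at_right_filter; exact: cF.
  + by apply: cvg_at_left_filter; exact: cF.
- by move=> x _; rewrite derive1E derive_val.
Qed.

(** The case of exponent zero, which gives L(0) and which the previous formula excludes by dividing
    by [D ^+ 2]. *)
Lemma integral_itv_id (R : realType) (a b : R) : a < b ->
  (\int[lebesgue_measure]_(x in `[a, b]) x%:E = ((b ^+ 2 - a ^+ 2) / 2)%:E)%E.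
Proof.
move=> ab; pose F x : R := x ^+ 2 / 2.
have dF (x : R) : is_derive x 1 F x.
  by apply: is_derive_eq; rewrite /GRing.scale/=; field.
have cF (x : R) : {for x, continuous F}.
  by apply: differentiable_continuous; apply/derivable1_diffP; exact: ex_derive.
rewrite (@continuous_FTC2 _ id F)//.
- by rewrite -EFinB /F; congr EFin; field.
- by apply: continuous_subspaceT => x; exact: cvg_id.
- split => //.
  + by apply: cvg_at_right_filter; exact: cF.
  + by apply: cvg_at_left_filter; exact: cF.
- by move=> x _; rewrite derive1E derive_val.
Qed.

(** * Measurability and the density of the output *)

Lemma measurable_fun_integral_snd d1 d2 (T1 : measurableType d1)
    (T2 : measurableType d2) (R : realType)
    (m2 : {sigma_finite_measure set T2 -> \bar R}) (f : T1 * T2 -> \bar R) :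
  measurable_fun setT f ->
  measurable_fun setT (fun x => \int[m2]_y f (x, y))%E.
Proof.
move=> mf.
(* Since [f] may change sign, Tonelli's measurability statement is applied to its positive and
   negative parts. *)
have -> : (fun x => \int[m2]_y f (x, y))%E =
    (fubini_F m2 (f ^\+)%E \- fubini_F m2 (f ^\-)%E)%E.
  apply/funext => x; rewrite integralE.
  by congr (_ - _)%E; apply: eq_integral => y _; rewrite ?funeposE ?funenegE.
apply: emeasurable_funB; apply: measurable_fun_fubini_tonelli_F => //.
- exact: measurable_funepos.
- exact: measurable_funeneg.
Qed.

Lemma measurable_laplace_pdf d (T : measurableType d) (R : realType)
    (f g : T -> R) : measurable_fun setT f -> measurable_fun setT g ->
  measurable_fun setT (fun x => laplace_pdf (f x) (g x)).
Proof.
move=> mf mg; apply: measurable_funM; first exact: measurable_funM.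
apply: measurableT_comp => //; apply: measurableT_comp => //.
by apply: measurable_funM => //; exact: measurableT_comp.
Qed.

Lemma laplace_pdf_ge0 (R : realType) (lam x : R) :
  0 <= lam -> 0 <= laplace_pdf lam x.
Proof. by move=> lam0; rewrite mulr_ge0 ?expR_ge0// divr_ge0. Qed.

(* [laplace_pdf] is negative at negative rates, which Tonelli's theorem cannot
   handle; these rates are cut off at [0]. *)
Lemma rdp_laplace_density d (T : measurableType d) (R : realType)
    (P : probability T R) (Lam : T -> R) (c : R) (S : set R) :
  measurable_fun setT Lam -> {ae P, forall w, 0 <= Lam w} -> measurable S ->
  (rdp_laplace P Lam c S = \int[lebesgue_measure]_(x in S)
    \int[P]_w (laplace_pdf (Num.max (Lam w) 0) (x - c))%:E)%E.
Proof.
move=> mLam Lam0 mS.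
(* The indicator of [S] turns the inner integral into one over the whole line, so that Tonelli
   applies on the product space. *)
pose k (f : T -> R) (z : T * R) : \bar R :=
  ((laplace_pdf (f z.1) (z.2 - c))%:E * (\1_S z.2)%:E)%E.
have mk f : measurable_fun setT f -> measurable_fun setT (k f).
  move=> mf; apply: emeasurable_funM; apply/measurable_EFinP.
    apply: measurable_laplace_pdf; first exact: measurableT_comp.
    exact: measurable_funB.
  exact: measurableT_comp.
have kE f w : (\int[lebesgue_measure]_(x in S) (laplace_pdf (f w) (x - c))%:E
               = \int[lebesgue_measure]_x k f (w, x))%E.
  rewrite integral_mkcond; apply: eq_integral => x _; rewrite patchE /k indicE.
  by case: ifP; rewrite ?mule1 ?mule0.
pose Lp w := Num.max (Lam w) 0.
have mLp : measurable_fun setT Lp by exact: measurable_maxr.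
have kp0 z : (0 <= k Lp z)%E.
  by rewrite mule_ge0// lee_fin laplace_pdf_ge0// le_max lexx orbT.
transitivity (\int[P]_w \int[lebesgue_measure]_x k Lp (w, x))%E.
  rewrite /rdp_laplace; under eq_integral do rewrite kE.
  apply: ae_eq_integral => //.
  - by apply: measurable_fun_integral_snd; exact: mk.
  - by apply: measurable_fun_integral_snd; exact: mk.
  apply: filterS Lam0 => w Lw _.
  by apply: eq_integral => x _; rewrite /k /Lp /= max_l.
rewrite fubini_tonelli//; last exact: mk.
rewrite [RHS]integral_mkcond; apply: eq_integral => x _; rewrite patchE /k/=.
rewrite indicE; case: ifP => _.
  by apply: eq_integral => w _; rewrite mule1.
by rewrite integral0_eq// => w _; rewrite mule0.
Qed.

(** The densities compare pointwise: L(x - c) <= e^eps L(|x - c| + D) <= e^eps L(x - c'), the last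
    step because |x - c'| <= |x - c| + D and L decreases with the absolute value. Integrating over
    [S] gives the claim. *)
Lemma rdp_laplace_le d (T : measurableType d) (R : realType)
    (P : probability T R) (Lam : T -> R) (D eps c c' : R) (S : set R) :
  measurable_fun setT Lam -> {ae P, forall w, 0 <= Lam w} -> 0 < D ->
  let L (s : R) : \bar R :=
    (\int[P]_w (laplace_pdf (Num.max (Lam w) 0) s)%:E)%E in
  (L 0%R < +oo)%E -> L D = ((expR (- eps))%:E * L 0%R)%E ->
  `|c - c'| <= D -> measurable S ->
  (rdp_laplace P Lam c S <= (expR eps)%:E * rdp_laplace P Lam c' S)%E.
Proof.
move=> mLam Lam0 D0 L L0oo LD cc' mS.
have mLp : measurable_fun setT (fun w => Num.max (Lam w) 0).
  exact: measurable_maxr.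
have Lp0 w : 0 <= Num.max (Lam w) 0 by rewrite le_max lexx orbT.
have L_ge0 s : (0 <= L s)%E.
  by apply: integral_ge0 => w _; rewrite lee_fin laplace_pdf_ge0.
have mL (u : R) :
    measurable_fun S (fun x : measurableTypeR R => L ((x : R) - u)).
  apply: measurable_funTS; apply: (@measurable_fun_integral_snd _ _ _ _ _ P
    (fun z : R * T => (laplace_pdf (Num.max (Lam z.2) 0) (z.1 - u))%:E)).
  apply/measurable_EFinP; apply: measurable_laplace_pdf.
    exact: (measurableT_comp mLp).
  exact: measurable_funB.
have mpdf s : measurable_fun setT
    (EFin \o fun w => laplace_pdf (Num.max (Lam w) 0) s).
  by apply/measurable_EFinP; apply: measurable_laplace_pdf.
pose w x := Num.max (Lam x) 0 / 2.
have LE s : 0 <= s ->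
    L s = (\int[P]_x (w x * expR (- (Num.max (Lam x) 0 * s)))%:E)%E.
  by move=> s0; apply: eq_integral => x _; rewrite /laplace_pdf ger0_norm.
have shift s : 0 <= s -> (L s <= (expR eps)%:E * L (s + D)%R)%E.
  move=> s0; rewrite !LE ?addr_ge0// ?(ltW D0)//.
  apply: laplace_transform_shift => //.
  - exact: measurable_funM.
  - by move=> x; rewrite divr_ge0.
  - by rewrite -LE.
  - by rewrite -!LE ?(ltW D0).
have anti s t : `|s| <= `|t| -> (L t <= L s)%E.
  move=> st; apply: ge0_le_integral => //.
  - by move=> x _; rewrite lee_fin laplace_pdf_ge0.
  - exact: mpdf.
  - exact: mpdf.
  move=> x _; rewrite lee_fin /laplace_pdf ler_wpM2l ?divr_ge0//.
  by rewrite ler_expR lerN2 ler_wpM2l.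
rewrite !rdp_laplace_density// -/L -ge0_integralZl//=; last 2 first.
- exact: mL.
- by move=> x _; exact: L_ge0.
apply: ge0_le_integral => //.
- by move=> x _; exact: L_ge0.
- exact: mL.
- exact: (measurable_funeM _ (mL c')).
move=> x _; rewrite -!/(L _).
(* Evenness of [L] is [anti] used in both directions. *)
have -> : L (x - c) = L `|x - c|.
  by apply/eqP; rewrite eq_le !anti// normr_id.
apply: le_trans (shift _ (normr_ge0 _)) _.
rewrite lee_pmul2l ?lte_fin ?expR_gt0//; apply: anti.
rewrite [leRHS]ger0_norm ?addr_ge0 ?(ltW D0)//.
have -> : x - c' = (x - c) + (c - c') by ring.
by apply: le_trans (ler_normD _ _) _; rewrite lerD2l.
Qed.

(** * Specialization to the uniform law *)

Lemma uniform_prob_ae_ge0 (R : realType) (a b : R) (ab : a < b) :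
  0 <= a -> {ae uniform_prob ab, forall x : R, 0 <= x}.
Proof.
move=> a0; exists `]-oo, 0[%classic; split => //.
- rewrite /uniform_prob integral0_eq// => x; rewrite /= in_itv/= => x0.
  by rewrite /uniform_pdf leNgt (lt_le_trans x0 a0).
- by move=> x /=/negP; rewrite -ltNge in_itv.
Qed.

(** The cutoff at 0 is invisible on [[a, b]] because [0 <= a]. The prefactor does not depend on [s],
    so it drops out of L(Dq)/L(0). *)
Lemma integral_uniform_laplace_pdf (R : realType) (a b s : R) (ab : a < b) :
  0 <= a -> 0 <= s ->
  (\int[uniform_prob ab]_x (laplace_pdf (Num.max x 0) s)%:E =
   ((b - a)^-1 / 2)%:E *
     \int[lebesgue_measure]_(x in `[a, b]) (x * expR (- (x * s)))%:E)%E.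
Proof.
move=> a0 s0; rewrite integral_uniform//; last 2 first.
- by apply/measurable_EFinP/measurable_laplace_pdf => //; exact: measurable_maxr.
- by move=> x; rewrite lee_fin laplace_pdf_ge0// le_max lexx orbT.
have ge0 x : `[a, b]%classic x -> 0 <= x.
  by rewrite /= in_itv/= => /andP[/(le_trans a0)].
rewrite EFinM -muleA; congr (_ * _)%E.
rewrite -ge0_integralZl//; last 2 first.
- apply/measurable_EFinP/measurable_funTS; apply: measurable_funM => //.
  apply: measurableT_comp => //; apply: measurableT_comp => //.
  exact: measurable_funM.
- by move=> x /ge0 x0; rewrite lee_fin mulr_ge0// expR_ge0.
apply: eq_integral => x; rewrite inE => /ge0 x0.
by rewrite max_l// -EFinM /laplace_pdf ger0_norm// mulrA [2^-1 * x]mulrC.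
Qed.

(** With h = y - x > 0, e^h > 1 + h gives (1 + x) e^h > (1 + x)(1 + h) = 1 + y + x h >= 1 + y. This
    fixes the sign of the denominator inside the logarithm. *)
Lemma one_plus_mul_expRN_lt (R : realType) (x y : R) : 0 <= x -> x < y ->
  (1 + y) * expR (- y) < (1 + x) * expR (- x).
Proof.
move=> x0 xy; rewrite [in ltRHS](_ : - x = (y - x) + - y); last by ring.
rewrite expRD mulrA ltr_pM2r ?expR_gt0//.
have := @expR_gt1Dx R (y - x); rewrite subr_eq0 gt_eqF// => /(_ isT).
by nra.
Qed.

Theorem mainTheorem11 (R : realType) (D : Type) (adj : D -> D -> Prop)
  (q : D -> R) (Dq a b : R) (ab : a < b) :
  (forall d d', adj d d' -> adj d' d) ->
  sensitivity adj q = Dq%:E -> 0 < Dq -> 0 <= a ->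
  let alpha := a * Dq in
  let beta := b * Dq in
  differentially_private adj
    (fun d => rdp_laplace (uniform_prob ab) (fun lam : R => lam) (q d))
    (ln ((alpha ^+ 2 - beta ^+ 2) /
         (2 * ((1 + beta) * expR (- beta) - (1 + alpha) * expR (- alpha))))).
Proof.
move=> _ sens Dq0 a0 alpha beta d d' dd' S mS.
set C := (X in ln X).
(* Numerator and denominator of [C] are both negative as stated; flipping both signs shows [0 < C],
   so that the exponential of [ln C] is [C]. *)
pose E := (1 + alpha) * expR (- alpha) - (1 + beta) * expR (- beta).
have alpha0 : 0 <= alpha by rewrite mulr_ge0// ltW.
have ab' : alpha < beta by rewrite ltr_pM2r.
have E0 : 0 < E by rewrite subr_gt0 one_plus_mul_expRN_lt.
have CE : C = (beta ^+ 2 - alpha ^+ 2) / (2 * E).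
  by rewrite /C -opprB -[in 2 * (_ - _)]opprB -/E mulrN invrN mulrNN.
have C0 : 0 < C.
  by rewrite CE divr_gt0 ?mulr_gt0// subr_gt0 ltrXn2r// ?ltW.
have L0 : (\int[lebesgue_measure]_(x in `[a, b]) (x * expR (- (x * 0)))%:E =
    ((b ^+ 2 - a ^+ 2) / 2)%:E)%E.
  rewrite -integral_itv_id//; apply: eq_integral => x _.
  by rewrite mulr0 oppr0 expR0 mulr1.
apply: (@rdp_laplace_le _ _ R _ _ Dq) => //.
- exact: uniform_prob_ae_ge0.
- by rewrite integral_uniform_laplace_pdf// L0 -EFinM ltry.
(* The ratio L(Dq)/L(0) is (E / Dq^2) / ((b^2 - a^2) / 2), which is 1/C once Dq^2 is absorbed into
   [alpha] and [beta]. *)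
- rewrite !integral_uniform_laplace_pdf ?(ltW Dq0)// L0.
  rewrite integral_itv_id_expR ?gt_eqF// -/alpha -/beta -/E.
  rewrite -!EFinM expRN lnK// CE /alpha /beta; congr EFin.
  clearbody E; field; rewrite (gt_eqF E0) (gt_eqF Dq0) subr_eq0 (gt_eqF ab).
  by rewrite subr_eq0 gt_eqF// ltrXn2r// ?ltW.
- rewrite -lee_fin -sens; apply: ereal_sup_ubound.
  by exists d, d'.
Qed.
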